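(* Let $f,h:\Sigma_3^*\to\Sigma_3^*$ be the morphisms $f(0)=0121,\ f(1)=021,\ f(2)=01$ and $h(0)=1210,\ h(1)=120,\ h(2)=10$. \begin{enumerate} \item Let $\mathbf{u}\in\Sigma_3^\omega$ be proper. Then some final segment (suffix) of $\mathbf{u}$ equals $f(\mathbf{v})$ for some proper $\mathbf{v}\in\Sigma_3^\omega$. \item Let $\mathbf{u}\in\Sigma_3^\omega$ be antiproper. Then some final segment of $\mathbf{u}$ equals $h(\mathbf{v})$ for some antiproper $\mathbf{v}\in\Sigma_3^\omega$. \end{enumerate}
   Context: $\Sigma_3=\{0,1,2\}$. For $u\in\Sigma_3^*$, its Parikh vector is $\pi(u)=[|u|_0,|u|_1,|u|_2]$, where $|u|_i$ is the number of occurrences of the letter $i$ in $u$. For $x,y\in\Sigma_3^*$ write $\pi(x)>\pi(y)$ if $|x|_i\ge |y|_i$ for all $i\in\Sigma_3$ and $|x|_i>|y|_i$ for at least one $i$. A finite word $u\in\Sigma_3^*$ is proper if (1) $u$ has no factor of the form $xyxyx$ with $\pi(x)>\pi(y)$, and (2) none of the words $00,11,22,20,10101,2121,10210210$ is a factor of $u$. An infinite word $\mathbf{u}\in\Sigma_3^\omega$ is proper if all its finite factors are proper. A finite word $u$ is antiproper if its reversal $u^R$ is proper; an infinite word is antiproper if all its finite factors are antiproper. A final segment of an infinite word is a suffix of it. *)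

(* Defs.v *)
From mathcomp Require Import all_boot all_algebra.

Set Implicit Arguments.
Unset Strict Implicit.
Unset Printing Implicit Defensive.

Notation letter := 'I_3.

Definition word (s : seq nat) : seq letter := [seq inZp i | i <- s].

Definition parikh (u : seq letter) : letter -> nat := fun i => count_mem i u.

Definition parikh_gt (x y : seq letter) : Prop :=
  (forall i : letter, parikh y i <= parikh x i) /\
  (exists i : letter, parikh y i < parikh x i).

Definition forbidden : seq (seq letter) :=
  [:: word [:: 0; 0]; word [:: 1; 1]; word [:: 2; 2]; word [:: 2; 0];
      word [:: 1; 0; 1; 0; 1]; word [:: 2; 1; 2; 1];
      word [:: 1; 0; 2; 1; 0; 2; 1; 0]].

(* [y] may be empty, so nonempty cubes [xxx] are excluded as well. *)
Definition proper (u : seq letter) : Prop :=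
  (forall x y : seq letter,
     infix (x ++ y ++ x ++ y ++ x) u -> ~ parikh_gt x y) /\
  (forall w : seq letter, w \in forbidden -> ~~ infix w u).

Definition antiproper (u : seq letter) : Prop := proper (rev u).

Definition infword := nat -> letter.

Definition suffix_from (n : nat) (u : infword) : infword := fun k => u (n + k).

Definition prefix_of (u : infword) (n : nat) : seq letter := mkseq u n.

Definition inf_proper (u : infword) : Prop :=
  forall i n : nat, proper (prefix_of (suffix_from i u) n).

Definition inf_antiproper (u : infword) : Prop :=
  forall i n : nat, antiproper (prefix_of (suffix_from i u) n).

(* The morphism of words determined by the images [g] of the letters. *)
Definition morph (g : letter -> seq letter) (w : seq letter) : seq letter :=
  flatten [seq g a | a <- w].

(* For nonerasing [g] the image of the prefix of length k + 1 has length at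
   least k + 1, so the default letter is never used; [inf_morph_prefix] shows
   that this is the usual extension of a morphism to infinite words. *)
Definition inf_morph (g : letter -> seq letter) (v : infword) : infword :=
  fun k => nth ord0 (morph g (prefix_of v k.+1)) k.

Definition f_letter (a : letter) : seq letter :=
  nth [::] [:: word [:: 0; 1; 2; 1]; word [:: 0; 2; 1]; word [:: 0; 1]] a.

Definition h_letter (a : letter) : seq letter :=
  nth [::] [:: word [:: 1; 2; 1; 0]; word [:: 1; 2; 0]; word [:: 1; 0]] a.

Lemma morph_cat g w1 w2 : morph g (w1 ++ w2) = morph g w1 ++ morph g w2.
Proof. by rewrite /morph map_cat flatten_cat. Qed.

Lemma size_morph g w : (forall a, g a != [::]) -> size w <= size (morph g w).
Proof.
move=> gn; elim: w => //= a w IH; rewrite /morph /= size_cat -addn1 addnC.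
by apply: leq_add => //; case: (g a) (gn a).
Qed.

Lemma prefix_of_cat v m n : prefix_of v (m + n) =
  prefix_of v m ++ prefix_of (suffix_from m v) n.
Proof.
rewrite /prefix_of /mkseq iotaD map_cat add0n; congr (_ ++ _).
by rewrite -[in LHS](addn0 m) iotaDl -map_comp.
Qed.

Lemma inf_morph_prefix g v n : (forall a, g a != [::]) ->
  prefix_of (inf_morph g v) (size (morph g (prefix_of v n))) =
  morph g (prefix_of v n).
Proof.
move=> gn; apply: (@eq_from_nth _ ord0) => [|k]; rewrite size_mkseq // => lt_k.
rewrite nth_mkseq // /inf_morph.
have lt_k' : k < size (morph g (prefix_of v k.+1)).
  by apply: leq_trans (size_morph _ gn); rewrite size_mkseq.
case: (leqP n k.+1) => [le_n | /ltnW le_k].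
  by rewrite -(subnKC le_n) prefix_of_cat morph_cat nth_cat lt_k.
by rewrite -(subnKC le_k) prefix_of_cat morph_cat nth_cat lt_k'.
Qed.

Lemma f_letter_nonerasing a : f_letter a != [::].
Proof. by case: a => [[|[|[|]]]]. Qed.

Lemma h_letter_nonerasing a : h_letter a != [::].
Proof. by case: a => [[|[|[|]]]]. Qed.

(* Main.v *)
Require Import Defs.
From mathcomp Require Import all_boot all_algebra.

Set Implicit Arguments.
Unset Strict Implicit.
Unset Printing Implicit Defensive.

(** In a proper word the gap between two consecutive 0s is 1, 21 or 121, so a
    proper infinite word is, from its first 0 on, an f-image f(v).  Since f
    preserves the order of Parikh vectors coordinatewise, a pattern xyxyx of v
    maps to the pattern f(x)f(y)f(x)f(y)f(x).  The f-image of a short forbidden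
    word, extended by two letters on the left and one on the right, contains a
    short forbidden word or one of four patterns xyxyx; so v is proper once its
    first two letters are dropped.  The antiproper case is the mirror image,
    because the reversal of h(w) is f applied to the reversal of w. *)

Definition letters : seq letter := word [:: 0; 1; 2].

Lemma all_letters (P : pred letter) : all P letters -> forall a, P a.
Proof.
move=> /allP Pl a; apply: Pl.
by case: a => [[|[|[|]]] lt_a] //; rewrite !inE -!val_eqE.
Qed.

Definition has_forbidden (u : seq letter) : bool :=
  has (fun w => infix w u) forbidden.

Lemma proper_no_forbidden u : Defs.proper u -> ~~ has_forbidden u.
Proof. by case=> _ noF; apply/hasPn => w /noF. Qed.

(** * Infinite images of a nonerasing morphism *)

Section InfiniteMorphism.

Variable g : letter -> seq letter.
Hypothesis g_neq0 : forall a, g a != [::].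

Lemma nth_inf_morph v n k : k < size (morph g (prefix_of v n)) ->
  inf_morph g v k = nth ord0 (morph g (prefix_of v n)) k.
Proof. by move=> lt_k; rewrite -inf_morph_prefix // nth_mkseq. Qed.

Lemma suffix_inf_morph m v :
  suffix_from (size (morph g (prefix_of v m))) (inf_morph g v)
    =1 inf_morph g (suffix_from m v).
Proof.
move=> k; rewrite /suffix_from (@nth_inf_morph v (m + k.+1)); last first.
  rewrite prefix_of_cat morph_cat size_cat ltn_add2l.
  by apply: leq_trans (size_morph _ g_neq0); rewrite size_mkseq.
by rewrite prefix_of_cat morph_cat nth_cat ltnNge leq_addr addKn.
Qed.

Lemma suffix_from_morph (u : infword) n v m :
  suffix_from n u =1 inf_morph g v ->
  exists n', suffix_from n' u =1 inf_morph g (suffix_from m v).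
Proof.
move=> uv; exists (n + size (morph g (prefix_of v m))) => k.
by rewrite -suffix_inf_morph /suffix_from -uv /suffix_from addnA.
Qed.

Lemma morph_factor (u : infword) n v i k : suffix_from n u =1 inf_morph g v ->
  exists m l, morph g (prefix_of (suffix_from i v) k) =
              prefix_of (suffix_from m u) l.
Proof.
move=> /(@suffix_from_morph _ _ _ i)[m uv].
exists m; exists (size (morph g (prefix_of (suffix_from i v) k))).
by rewrite -[LHS]inf_morph_prefix //; apply: eq_mkseq => j; rewrite uv.
Qed.

(** [P] marks the positions where a block may start. Reading one block leads from a marked position
    to another, so iteration from [n] cuts the whole suffix into blocks. *)
Lemma parse_inf_morph (P : pred nat) u n : P n ->
    (forall m, P m -> exists a,
       (prefix_of (suffix_from m u) (size (g a)) == g a) &&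
       P (m + size (g a))) ->
  exists v, suffix_from n u =1 inf_morph g v.
Proof.
move=> Pn step.
pose ok m a := (prefix_of (suffix_from m u) (size (g a)) == g a) &&
               P (m + size (g a)).
(* The default [ord0] is never taken at a position satisfying [P]. *)
pose next m : letter := odflt ord0 [pick a | ok m a].
have nextP m : P m -> ok m (next m).
  by move=> /step [a oka]; rewrite /next; case: pickP => //= /(_ a);
    rewrite /ok oka.
pose pos k := iter k (fun m => m + size (g (next m))) n.
have Ppos k : P (pos k) by elim: k => //= k /nextP /andP[].
pose v k := next (pos k).
have parsed k : pos k = n + size (morph g (prefix_of v k)) /\
    prefix_of (suffix_from n u) (size (morph g (prefix_of v k))) =
    morph g (prefix_of v k).
  elim: k => [|k [posE prefE]]; first by rewrite addn0.
  have -> : prefix_of v k.+1 = prefix_of v k ++ [:: v k].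
    by rewrite /prefix_of mkseqS cats1.
  have morph1 : morph g [:: v k] = g (v k) by rewrite /morph /= cats0.
  rewrite morph_cat size_cat addnA -posE morph1; split=> //.
  rewrite prefix_of_cat prefE; congr (_ ++ _).
  have /andP[/eqP <- _] := nextP _ (Ppos k); rewrite size_mkseq.
  by apply: eq_mkseq => j; rewrite /suffix_from addnA -posE.
exists v => k.
have lt_k : k < size (morph g (prefix_of v k.+1)).
  by apply: leq_trans (size_morph _ g_neq0); rewrite size_mkseq.
by rewrite /inf_morph -(parsed k.+1).2 nth_mkseq.
Qed.

End InfiniteMorphism.

(** * Parikh vectors and forbidden words under f *)

Lemma parikh_morph g a w :
  parikh (morph g w) a = \sum_(b : letter) parikh w b * parikh (g b) a.
Proof.
rewrite /parikh; elim: w => [|c w IH]; first by rewrite big1.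
rewrite /morph /= count_cat -/(morph g w) IH.
under [RHS]eq_bigr => b _ do rewrite mulnDl.
rewrite big_split /=; congr (_ + _).
rewrite (bigD1 c) //= eqxx mul1n big1 ?addn0 // => b /negbTE.
by rewrite eq_sym => ->.
Qed.

Lemma parikh_gt_morph_f x y : parikh_gt x y ->
  parikh_gt (morph f_letter x) (morph f_letter y).
Proof.
move=> [le_yx [i lt_i]]; split=> [a|].
  by rewrite !parikh_morph leq_sum // => b _; rewrite leq_mul2r le_yx orbT.
(* Strictness survives at 0, which occurs in the image of every letter. *)
exists ord0; rewrite !parikh_morph (bigD1 i) //= [ltnRHS](bigD1 i) //=.
rewrite -addSn leq_add //; last first.
  by rewrite leq_sum // => b _; rewrite leq_mul2r le_yx orbT.
rewrite ltn_pmul2r //.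
by move: (i) => {i lt_i}; apply: all_letters; vm_compute.
Qed.

Lemma infix_morph g x w : infix x w -> infix (morph g x) (morph g w).
Proof.
by move=> /infixP[s [t ->]]; rewrite !morph_cat; apply/infixP; do 2 eexists.
Qed.

(* The pairs (x, y) whose xyxyx occurs in the extended images of 00, 10101, 2121
   and 10210210, in this order; every image is preceded by a 1. *)
Definition forbidden_patterns : seq (seq letter * seq letter) :=
  [:: (word [:: 2; 1; 0], word [:: 1]);
      (word [:: 1; 0; 2; 1; 0], word [:: 1; 2]);
      (word [:: 2; 1; 0], word [:: 1; 0]);
      (word [:: 1; 0; 2; 1; 0; 1; 2; 1; 0], [::])].

Lemma forbidden_patterns_gt x y : (x, y) \in forbidden_patterns -> parikh_gt x y.
Proof.
move=> xyF.
have /allP/(_ _ xyF)/andP[/allP le_yx /hasP[i _ lt_i]] : all (fun p =>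
    all (fun i => parikh p.2 i <= parikh p.1 i) letters &&
    has (fun i => parikh p.2 i < parikh p.1 i) letters) forbidden_patterns.
  by vm_compute.
by split; [apply: all_letters; apply/allP | exists i].
Qed.

Definition has_obstruction (u : seq letter) : bool :=
  has_forbidden u ||
  has (fun p => infix (p.1 ++ p.2 ++ p.1 ++ p.2 ++ p.1) u) forbidden_patterns.

(** The letter [r] supplies the 0 that begins every image. For 00 and 2121 the pattern begins with
    210, whose 21 ends the image of [q] unless [q] is 2; in that case the 1 ending the image of [p]
    completes 10101. *)
Lemma has_obstruction_f z p q r : z \in forbidden ->
  has_obstruction (morph f_letter ([:: p; q] ++ z ++ [:: r])).
Proof.
move=> zF.
suff /allP/(_ z zF) chk : all (fun z => all (fun p => all (fun q => all (fun r =>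
    has_obstruction (morph f_letter ([:: p; q] ++ z ++ [:: r])))
    letters) letters) letters) forbidden.
  exact: all_letters (all_letters (all_letters chk p) q) r.
by vm_compute.
Qed.

Lemma proper_no_obstruction u : Defs.proper u -> ~~ has_obstruction u.
Proof.
move=> proper_u; rewrite negb_or proper_no_forbidden //.
apply/hasPn => -[x y] /forbidden_patterns_gt gt_xy /=; apply/negP => inf_xy.
by case: proper_u => /(_ x y inf_xy).
Qed.

Lemma proper_desubst_f p q w r :
  Defs.proper (morph f_letter ([:: p; q] ++ w ++ [:: r])) -> Defs.proper w.
Proof.
move=> proper_fw; have [noP _] := proper_fw; split=> [x y xyw gt_xy|z zF].
  apply: noP (parikh_gt_morph_f gt_xy); rewrite -!morph_cat.
  by apply: infix_morph; apply: infix_trans xyw (infix_infix _ _ _).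
apply/negP => /infixP[s [t wE]].
(* The two letters just before [z] come from [p] and [q] when [s] is too short. *)
have [s' [p' [q' sE]]] : exists s' p' q', [:: p, q & s] = s' ++ [:: p'; q'].
  case: (lastP s) => [|s1 b]; first by exists [::], p, q.
  case: (lastP s1) => [|s2 a]; first by exists [:: p], q, b.
  by exists [:: p, q & s2], a, b; rewrite -!cats1 /= -catA.
have [r' [t' tE]] : exists r' t', t ++ [:: r] = [:: r'] ++ t'.
  by case: t {wE} => [|c t]; [exists r, [::] | exists c, (t ++ [:: r])].
move/negP: (proper_no_obstruction proper_fw); apply.
have -> : [:: p; q] ++ w ++ [:: r] = s' ++ ([:: p'; q'] ++ z ++ [:: r']) ++ t'.
  transitivity ([:: p, q & s] ++ z ++ t ++ [:: r]); first by rewrite wE -!catA.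
  by rewrite sE tE -!catA.
set m := _ ++ _ ++ [:: r'].
have inf_m : infix (morph f_letter m) (morph f_letter (s' ++ m ++ t')).
  exact/infix_morph/infix_infix.
have /orP[/hasP[x xF xm]|/hasP[x xF xm]] := has_obstruction_f p' q' r' zF;
  apply/orP; [left|right]; apply/hasP; exists x => //;
  exact: infix_trans xm inf_m.
Qed.

(** * Cutting words into blocks at their zeros *)

Lemma check_no_forbidden6 (P : pred (seq letter)) :
  all (fun a => all (fun b => all (fun c => all (fun d => all (fun e => all
    (fun k => has_forbidden [:: a; b; c; d; e; k] || P [:: a; b; c; d; e; k])
    letters) letters) letters) letters) letters) letters ->
  forall s, size s = 6 -> ~~ has_forbidden s -> P s.
Proof.
move=> chk [|a [|b [|c [|d [|e [|k []]]]]]] // _ /negbTE noF.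
have := all_letters (all_letters (all_letters (all_letters (all_letters
  (all_letters chk a) b) c) d) e) k.
by rewrite noF.
Qed.

Lemma zero_in6 s : size s = 6 -> ~~ has_forbidden s -> ord0 \in s.
Proof.
move=> size_s noF; pose P (t : seq letter) := ord0 \in t.
have // : P s by apply: check_no_forbidden6 => //; vm_compute.
Qed.

(** Five letters would not suffice: 01212 has no forbidden factor and starts with no complete block,
    but any sixth letter creates 20, 2121 or 22. *)
Lemma f_block_prefix s : size s = 6 -> ~~ has_forbidden s ->
  head ord0 s = ord0 -> exists a, prefix (rcons (f_letter a) ord0) s.
Proof.
move=> size_s noF /eqP hd0.
pose P t := (head ord0 t == ord0) ==>
  has (fun a => prefix (rcons (f_letter a) ord0) t) letters.
have /implyP/(_ hd0)/hasP[a _ pre_a] : P s; last by exists a.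
by apply: check_no_forbidden6 => //; vm_compute.
Qed.

(** Images under h end in 0 instead of beginning with it, so a block is recognised by the 0 that
    precedes it. *)
Lemma h_block_prefix s : size s = 6 -> ~~ has_forbidden (rev s) ->
  head ord0 s = ord0 -> exists a, prefix (ord0 :: h_letter a) s.
Proof.
move=> size_s noF /eqP hd0.
pose P t := (head ord0 (rev t) == ord0) ==>
  has (fun a => prefix (ord0 :: h_letter a) (rev t)) letters.
have /implyP : P (rev s).
  by apply: check_no_forbidden6; rewrite ?size_rev //; vm_compute.
by rewrite revK => /(_ hd0)/hasP[a _ pre_a]; exists a.
Qed.

Lemma prefix_prefix_of x m (u : infword) n :
  prefix x (prefix_of (suffix_from m u) n) ->
  prefix_of (suffix_from m u) (size x) = x.
Proof.
move=> pre_x; have le_n := size_prefix pre_x; rewrite size_mkseq in le_n.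
move: pre_x; rewrite prefixE => /eqP {2}<-.
by rewrite /prefix_of /mkseq -map_take take_iota (minn_idPl le_n).
Qed.

Lemma rev_morph_h w : rev (morph h_letter w) = morph f_letter (rev w).
Proof.
elim: w => // a w IH; rewrite rev_cons -cats1 morph_cat -IH.
rewrite -cat1s morph_cat rev_cat; congr (_ ++ _); rewrite /morph /= !cats0.
by apply/eqP; move: a; apply: all_letters; vm_compute.
Qed.

(** Only the letters of [s] matter, so [s] can be the prefix of [u] or its reversal. *)
Lemma ex_zero (u : infword) s : size s = 6 -> ~~ has_forbidden s ->
  s =i prefix_of u 6 -> exists n, u n == ord0.
Proof.
move=> size_s noF su; have := zero_in6 size_s noF.
by rewrite su => /mapP[n _ u0]; exists n; rewrite -u0.
Qed.

Lemma proper_parse (u : infword) : inf_proper u ->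
  exists n v, suffix_from n u =1 inf_morph f_letter v.
Proof.
move=> proper_u.
have noF m : ~~ has_forbidden (prefix_of (suffix_from m u) 6).
  exact: proper_no_forbidden (proper_u m 6).
have [n u0] : exists n, u n == ord0.
  by apply: (ex_zero (size_mkseq _ _) (noF 0)) => a.
exists n; apply: (parse_inf_morph f_letter_nonerasing
  (P := fun m => u m == ord0)) => // m /eqP um0.
have [|a /prefix_prefix_of] := f_block_prefix (size_mkseq _ _) (noF m).
  by rewrite /= /suffix_from addn0.
(* The appended 0 is the start of the next block. *)
rewrite size_rcons /prefix_of mkseqS => /rcons_inj[pre_a ua0].
by exists a; rewrite pre_a eqxx -ua0 /=.
Qed.

Lemma antiproper_parse (u : infword) : inf_antiproper u ->
  exists n v, suffix_from n u =1 inf_morph h_letter v.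
Proof.
move=> proper_u.
have noF m : ~~ has_forbidden (rev (prefix_of (suffix_from m u) 6)).
  exact: proper_no_forbidden (proper_u m 6).
have [n u0] : exists n, u n == ord0.
  apply: (ex_zero (s := rev (prefix_of u 6)) _ (noF 0)) => [|a].
    by rewrite size_rev size_mkseq.
  by rewrite mem_rev.
(* The zero at [n] closes a block, so parsing starts one position later. In the shifted word,
   [u m == ord0] says that the letter just before position [m] is 0. *)
suff [v vE] : exists v,
    suffix_from n (suffix_from 1 u) =1 inf_morph h_letter v.
  by exists n.+1, v => k; rewrite -vE.
apply: (parse_inf_morph h_letter_nonerasing
  (P := fun m => u m == ord0)) => // m /eqP um0.
have [|a /prefix_prefix_of] := h_block_prefix (size_mkseq _ _) (noF m).
  by rewrite /= /suffix_from addn0.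
rewrite /= -[X in prefix_of _ X]add1n prefix_of_cat => -[_ pre_a].
have hE : prefix_of (suffix_from m (suffix_from 1 u)) (size (h_letter a)) =
    h_letter a.
  by rewrite -[RHS]pre_a; apply: eq_mkseq => k; rewrite /suffix_from addnCA.
exists a; rewrite hE eqxx /=.
have <- : last ord0 (h_letter a) = ord0.
  by apply/eqP; move: a {pre_a hE}; apply: all_letters; vm_compute.
have size_gt0 : 0 < size (h_letter a).
  by move: a {pre_a hE}; apply: all_letters; vm_compute.
rewrite -nth_last -[X in nth _ X _]hE nth_mkseq ?prednK //.
by rewrite /suffix_from addnCA add1n prednK.
Qed.

(** * Properness of the preimage *)

Lemma factor_cat (v : infword) i m k :
  prefix_of (suffix_from i v) (m + k) =
  prefix_of (suffix_from i v) m ++ prefix_of (suffix_from i (suffix_from m v)) k.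
Proof.
rewrite prefix_of_cat; congr (_ ++ _); apply: eq_mkseq => j.
by rewrite /suffix_from addnCA.
Qed.

Theorem theorem1 :
  (forall u : infword, inf_proper u ->
     exists (n : nat) (v : infword),
       inf_proper v /\ suffix_from n u =1 inf_morph f_letter v) /\
  (forall u : infword, inf_antiproper u ->
     exists (n : nat) (v : infword),
       inf_antiproper v /\ suffix_from n u =1 inf_morph h_letter v).
Proof.
split=> u proper_u.
  have [n0 [v0 uv0]] := proper_parse proper_u.
  (* Dropping two letters gives every factor of the new word two letters of left context in [v0];
     the length [2 + (k + 1)] below adds one on the right. *)
  have [n uv] := suffix_from_morph f_letter_nonerasing 2 uv0.
  exists n, (suffix_from 2 v0); split=> // i k.
  have [m [l fE]] := morph_factor f_letter_nonerasing i (2 + (k + 1)) uv0.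
  have := proper_u m l; rewrite -fE factor_cat prefix_of_cat.
  exact: proper_desubst_f.
have [n0 [v0 uv0]] := antiproper_parse proper_u.
(* Reversal exchanges the margins: one letter on the left, two on the right. *)
have [n uv] := suffix_from_morph h_letter_nonerasing 1 uv0.
exists n, (suffix_from 1 v0); split=> // i k.
have [m [l hE]] := morph_factor h_letter_nonerasing i (1 + (k + 2)) uv0.
have := proper_u m l; rewrite /antiproper -hE rev_morph_h factor_cat.
rewrite prefix_of_cat !rev_cat -catA; exact: proper_desubst_f.
Qed.
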